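(* Let $\underline x_*<x_*^\kappa<x_*^\lambda<\overline x_*$ be real numbers, let $I_1^*=(\underline x_*,x_*^\kappa)$, $I_2^*=(x_*^\kappa,x_*^\lambda)$, $I_3^*=(x_*^\lambda,\overline x_* )$, and define $$\kappa^*(x)=\begin{cases}+\delta,&x\ge x_*^\kappa,\\-\delta,&x<x_*^\kappa,\end{cases}\qquad\lambda^*(x)=\begin{cases}r(1+\varepsilon),&x\le x_*^\lambda,\\ r(1-\varepsilon),&x>x_*^\lambda.\end{cases}$$ Let $H_*:\mathbb R\to\mathbb R$ satisfy $$\begin{cases} (\mathbb L^{\kappa^*,\lambda^*}H_* )(x)+c'(x)=0,& x\in I_1^*\cup I_2^*\cup I_3^*,\\ H_*(x)=-c_U,& x\le\underline x_*,\\ H_*(x)=c_D,& x\ge\overline x_*,\\ H_*(x_*^\kappa)=0,\\ (\mathbb JH_* )(x_*^\lambda)=0,\\ H_*\in C^1(\mathbb R),\quad H_*\in C^3(I_1^*\cup I_2^*\cup I_3^* ). \end{cases}$$ Assume that: (i) the jump distribution $F$ satisfies $\mathrm{supp}(F)\subset(-\infty,0]$ and $\mathbb P(Y<0)>0$; (ii) the drift is constant, $b(x)\equiv b$; (iii) $c\in C^2(\mathbb R)$ is convex everywhere, strictly convex in $[\underline x_*,\overline x_*]$, and attains its unique minimum at $x=0$; (iv) $H_*'(x_*^\kappa)>0$ and $H_*'(x_*^\lambda)>0$. Let $V_*$ be such that $V_*'=H_*$ and let $\gamma_*=c_U(\delta\sigma-b-\varepsilon r\,\mathbb E[Y])+c(\underline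 x_* )$. Then the pair $(V,\gamma)=(V_*,\gamma_* )$, with $\underline x=\underline x_*$ and $\overline x=\overline x_*$, solves the free-boundary problem $$\begin{cases} (\mathbb L^{V}V)(x)+c(x)=\gamma, & x\in[\underline x,\overline x],\\ (\mathbb L^{V}V)(x)+c(x)\ge\gamma, & x\notin[\underline x,\overline x],\\ V'(x)\in[-c_U,c_D], & x\in(\underline x,\overline x),\\ V'(x)=-c_U, & x\le\underline x,\\ V'(x)=c_D, & x\ge\overline x,\\ V\in C^2(\mathbb R). \end{cases}$$
   Context: Parameters: $\sigma>0$, $r>0$, $\delta\ge0$, $0\le\varepsilon<1$, $c_U,c_D>0$. $F$ is the distribution (also its distribution function $F(y)=\mathbb P(Y\le y)$) of a real random variable $Y$ with $\mathbb E[|Y|]<\infty$; $c:\mathbb R\to\mathbb R$ is the running cost and $b$ the drift. Operators: $(\Psi f)(x)=\int_{\mathbb R}f(x+y)\,dF(y)-f(x)$; $(\mathbb Jf)(x)=\int_{-\infty}^0f(x+y)F(y)\,dy$; and for functions $\kappa,\lambda$ on $\mathbb R$, $$(\mathbb L^{\kappa,\lambda}f)(x)=(b(x)+\sigma\kappa(x)-r\mathbb E[Y])f'(x)+\tfrac12\sigma^2f''(x)+\lambda(x)(\Psi f)(x).$$ In the concluding free-boundary problem, $\mathbb L^{V}:=\mathbb L^{\kappa^V,\lambda^V}$ is the generator with the bang-bang distortions determined by $V$: $$\kappa^V(x)=\begin{cases}+\delta,&V'(x)\ge0,\\-\delta,&V'(x)<0,\end{cases}\qquad \lambda^V(x)=\begin{cases}r(1+\varepsilon),&(\Psi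 V)(x)\ge0,\\ r(1-\varepsilon),&(\Psi V)(x)<0.\end{cases}$$ *)

(* Defs.v *)
From HB Require Import structures.
From mathcomp Require Import all_boot all_order all_algebra.
From mathcomp Require Import all_classical all_reals all_analysis.

Set Implicit Arguments.
Unset Strict Implicit.
Unset Printing Implicit Defensive.

Import Order.TTheory GRing.Theory Num.Theory.
Import numFieldNormedType.Exports.

Local Open Scope classical_set_scope.
Local Open Scope ring_scope.

(* Meant for open U only: derivatives are two-sided and iterated on all of R,
   so for open U they only depend on the restriction of f to U.  The
   derivatives of order less than n are continuous on U, being derivable. *)
Definition Ck_on (R : realType) (n : nat) (U : set R) (f : R -> R) : Prop :=
  (forall k x, (k < n)%N -> U x -> derivable (f^`(k))%classic x 1) /\
  (forall x, U x -> {for x, continuous (f^`(n))%classic}).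

Definition strictly_convex_on (R : realType) (D : set R) (f : R -> R) : Prop :=
  forall x y t, D x -> D y -> x != y -> 0 < t < 1 ->
    f (t * x + (1 - t) * y) < t * f x + (1 - t) * f y.

Definition msupport (R : realType)
    (mu : set (measurableTypeR R) -> \bar R) : set R :=
  [set x | forall U : set R, open U -> U x -> (0 < mu U)%E].

Section operators.
Context (d : measure_display) (T : measurableType d) (R : realType).
Variables (P : probability T R) (Y : {RV P >-> R}).

(* The real-valued integrals below take an unspecified value when the
   integrand is not integrable.  Since E|Y| < oo, that does not happen for
   Psi f when f grows at most linearly (in particular when f' is bounded), nor
   for Jop f when f is bounded and measurable. *)
Definition Psi (f : R -> R) (x : R) : R :=
  (\int[distribution P Y]_y f (x + y)) - f x.

Definition Jop (f : R -> R) (x : R) : R :=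
  \int[lebesgue_measure]_(y in `]-oo, 0]) (f (x + y) * fine (cdf Y y)).

Variables (sigma r : R) (b : R -> R).

Definition Lop (kappa lambda : R -> R) (f : R -> R) (x : R) : R :=
  (b x + sigma * kappa x - r * fine ('E_P[Y])%E) * (f^`())%classic x
  + 2^-1 * sigma ^+ 2 * (f^`(2))%classic x + lambda x * Psi f x.

Variables (delta eps : R).

Definition kappaV (V : R -> R) (x : R) : R :=
  if 0 <= (V^`())%classic x then delta else - delta.

Definition lambdaV (V : R -> R) (x : R) : R :=
  if 0 <= Psi V x then r * (1 + eps) else r * (1 - eps).

Definition LV (V : R -> R) : R -> R := Lop (kappaV V) (lambdaV V) V.

Variables (cU cD : R) (c : R -> R).

Definition solves_free_boundary_problem
    (xlo xhi : R) (V : R -> R) (gamma : R) : Prop :=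
  [/\ (forall x, x \in `[xlo, xhi] -> LV V x + c x = gamma),
      (forall x, x \notin `[xlo, xhi] -> LV V x + c x >= gamma),
      (forall x, x \in `]xlo, xhi[ -> (V^`())%classic x \in `[- cU, cD]),
      ((forall x, x <= xlo -> (V^`())%classic x = - cU) /\
       (forall x, xhi <= x -> (V^`())%classic x = cD)) &
      Ck_on 2 setT V].

Definition kappa_star (xkappa x : R) : R :=
  if xkappa <= x then delta else - delta.

Definition lambda_star (xlambda x : R) : R :=
  if x <= xlambda then r * (1 + eps) else r * (1 - eps).

Definition solves_H_problem (xlo xkappa xlambda xhi : R) (H : R -> R) : Prop :=
  let I123 : set R :=
    (`]xlo, xkappa[ `|` `]xkappa, xlambda[ `|` `]xlambda, xhi[)%classic in
  [/\ (forall x, I123 x ->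
         Lop (kappa_star xkappa) (lambda_star xlambda) H x
         + (c^`())%classic x = 0),
      ((forall x, x <= xlo -> H x = - cU) /\ (forall x, xhi <= x -> H x = cD)),
      (H xkappa = 0 :> R),
      (Jop H xlambda = 0 :> R) &
      (Ck_on 1 setT H /\ Ck_on 3 I123 H)].

End operators.

(* Main.v *)
Require Import Defs.
From HB Require Import structures.
From mathcomp Require Import all_boot all_order all_algebra.
From mathcomp Require Import all_classical all_reals all_analysis.
From mathcomp Require Import measurable_realfun ring lra.

Set Implicit Arguments.
Unset Strict Implicit.
Unset Printing Implicit Defensive.

Import Order.TTheory GRing.Theory Num.Theory.
Import numFieldNormedType.Exports.

Local Open Scope classical_set_scope.
Local Open Scope ring_scope.
(** Why the theorem holds.

    Write h for the derivative of H and L for the generator, so that H is the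
    derivative of V.  Since the jumps are nonpositive and V' = H, Tonelli's
    and Fubini's theorems give Psi V = - J H [Psi_antiderivative], and
    differentiating under the integral gives (Psi V)' = Psi H and
    (Psi H)' = Psi h [is_derive_Psi].

    The heart of the matter is that V is convex, i.e. h >= 0 [h_ge0].  Outside
    (xlo, xhi) the function H is constant, so h = 0 there.  If h took a negative
    value, it would have a leftmost global minimum point x, which lies in one of
    the three intervals where the equation for H holds, because h > 0 at the two
    switching points.  There the equation expresses h' as
    - (2 / sigma^2) (A h + lambda Psi H + c'), where the drift coefficient A and
    the intensity lambda are constant, and at x the right-hand side has derivative
    - (2 / sigma^2) (lambda Psi h x + c'' x).  This is negative: c'' >= 0, and
    Psi h x > 0 because negative jumps occur with positive probability and lead
    to points to the left of x, where h is strictly larger.  Then h decreases to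
    the right of x, which is absurd.

    Convexity settles the signs.  H is nondecreasing and vanishes at xkappa;
    Psi V is nonincreasing, as Psi H <= 0, and vanishes at xlambda.  The
    distortions chosen by V enter the generator through delta |V'| and
    r eps |Psi V| only, so they may be replaced by the prescribed switches
    [LV_generator_cost].  L V + c is then continuous across the switches and its
    derivative L H + c' is zero on each of the three intervals, hence it equals
    on [xlo, xhi] its value at xlo, which is gamma.

    Outside [xlo, xhi] the convexity of V is used once more, at the end points.
    The function h leaves the value 0 at xlo upwards, so its equation forces
    c' xlo <= 0 [dc_xlo_le0], and c >= c xlo to the left of xlo.  It reaches 0 at
    xhi from above, so its equation forces
    r (1 - eps) Psi H xhi + c' xhi >= 0 [marginal_cost_xhi_ge0].  To the right of
    xhi the function r (1 - eps) Psi H + c' is the derivative of L V + c, and it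
    is nondecreasing there. *)

(** * One-variable calculus *)
Section calculus.
Context {R : realType}.
Implicit Types (f g df c : R -> R) (a b x y l : R).

Lemma is_derive1_continuous f df :
  (forall x, is_derive x (1 : R) f (df x)) -> continuous f.
Proof.
by move=> dfE x; apply/differentiable_continuous/derivable1_diffP; case: (dfE x).
Qed.

Lemma is_derive1_gt0_right f a l : is_derive a (1 : R) f l -> 0 < l ->
  \forall x \near a^'+, f a < f x.
Proof.
move=> [dfa dE] l0.
have : (h^-1 *: (f (h *: (1 : R) + a) - f a)) @[h --> 0^'] --> l.
  by rewrite -dE; exact: dfa.
move=> /cvgr_gt /(_ _ l0) /nbhs_ballP [e /= e0 He].
near=> x.
have ax : 0 < x - a by rewrite subr_gt0; near: x; exact: nbhs_right_gt.
have xae : x - a < e.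
  by rewrite ltrBlDl; near: x; apply: nbhs_right_lt; rewrite ltrDl.
have := He (x - a); rewrite /ball/= sub0r normrN gtr0_norm// => /(_ xae).
rewrite gt_eqF// => /(_ isT).
by rewrite !scaler1 subrK /GRing.scale/= pmulr_rgt0 ?invr_gt0// subr_gt0.
Unshelve. all: by end_near. Qed.

Lemma is_derive1_gt0_left f a l : is_derive a (1 : R) f l -> 0 < l ->
  \forall x \near a^'-, f x < f a.
Proof.
move=> [dfa dE] l0.
have : (h^-1 *: (f (h *: (1 : R) + a) - f a)) @[h --> 0^'] --> l.
  by rewrite -dE; exact: dfa.
move=> /cvgr_gt /(_ _ l0) /nbhs_ballP [e /= e0 He].
near=> x.
have ax : x - a < 0 by rewrite subr_lt0; near: x; exact: nbhs_left_lt.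
have xae : - (x - a) < e.
  rewrite opprB ltrBlDr -ltrBlDl; near: x; apply: nbhs_left_gt.
  by rewrite gtrBl.
have := He (x - a); rewrite /ball/= sub0r normrN ltr0_norm// => /(_ xae).
rewrite lt_eqF// => /(_ isT).
by rewrite !scaler1 subrK /GRing.scale/= nmulr_rgt0 ?invr_lt0// subr_lt0.
Unshelve. all: by end_near. Qed.

(** A two-sided derivative is determined by either side; this gives the value of
    the derivative at the end point of a half-line on which f is constant. *)
Lemma is_derive1_eq0_left f a l : is_derive a (1 : R) f l ->
  (forall x, x <= a -> f x = f a) -> l = 0.
Proof.
move=> dfa fE; apply/eqP; rewrite eq_le !leNgt; apply/andP; split; apply/negP => l0.
- have [x [/= xa]] := filter_ex (filterI (nbhs_left_lt a) (is_derive1_gt0_left dfa l0)).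
  by rewrite fE ?ltxx// ltW.
- have dNf : is_derive a (1 : R) (\- f) (- l) by exact: is_deriveN.
  rewrite -oppr_gt0 in l0.
  have [x [/= xa]] := filter_ex (filterI (nbhs_left_lt a) (is_derive1_gt0_left dNf l0)).
  by rewrite fE ?ltxx// ltW.
Qed.

Lemma is_derive1_eq0_right f a l : is_derive a (1 : R) f l ->
  (forall x, a <= x -> f x = f a) -> l = 0.
Proof.
move=> dfa fE; apply/eqP; rewrite eq_le !leNgt; apply/andP; split; apply/negP => l0.
- have [x [/= xa]] := filter_ex (filterI (nbhs_right_gt a) (is_derive1_gt0_right dfa l0)).
  by rewrite fE ?ltxx// ltW.
- have dNf : is_derive a (1 : R) (\- f) (- l) by exact: is_deriveN.
  rewrite -oppr_gt0 in l0.
  have [x [/= xa]] := filter_ex (filterI (nbhs_right_gt a) (is_derive1_gt0_right dNf l0)).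
  by rewrite fE ?ltxx// ltW.
Qed.

(** The derivative is controlled only on a punctured one-sided neighbourhood, so
    that a can be an end point of the interval where a formula for it is known. *)
Lemma decreases_right f df a : continuous f ->
  (\forall x \near a^'+, is_derive x (1 : R) f (df x) /\ df x < 0) ->
  exists x, f x < f a.
Proof.
move=> cf /nbhs_ballP [e /= e0 He].
have H x : a < x -> x < a + e -> is_derive x (1 : R) f (df x) /\ df x < 0.
  move=> ax xe; apply: He => //; rewrite /ball/= distrC gtr0_norm ?subr_gt0//.
  by rewrite ltrBlDl.
have ae : a < a + e / 2 by rewrite ltrDl divr_gt0.
have ee : a + e / 2 < a + e by rewrite ltrD2l ltr_pdivrMr// mulr_natr mulr2n ltrDr.
have [x xI D] : exists2 x, x \in `]a, a + e / 2[ &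
    f (a + e / 2) - f a = df x * (a + e / 2 - a).
  apply: MVT => //; last exact: continuous_subspaceT.
  by move=> x /[!in_itv]/= /andP[? xe]; apply: (H _ _ _).1 => //; exact: lt_trans ee.
exists (a + e / 2); rewrite -subr_lt0 D; move: xI; rewrite in_itv/= => /andP[? xe].
by rewrite nmulr_rlt0 ?subr_gt0//; apply: (H _ _ _).2 => //; exact: lt_trans ee.
Qed.

Lemma decreases_left f df a : continuous f ->
  (\forall x \near a^'-, is_derive x (1 : R) f (df x) /\ 0 < df x) ->
  exists x, f x < f a.
Proof.
move=> cf /nbhs_ballP [e /= e0 He].
have H x : x < a -> a - e < x -> is_derive x (1 : R) f (df x) /\ 0 < df x.
  move=> ax xe; apply: He => //; rewrite /ball/= gtr0_norm ?subr_gt0//.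
  by rewrite ltrBlDr -ltrBlDl.
have ae : a - e / 2 < a by rewrite gtrBl divr_gt0.
have ee : a - e < a - e / 2.
  by rewrite ltrD2l ltrN2 ltr_pdivrMr// mulr_natr mulr2n ltrDr.
have [x xI D] : exists2 x, x \in `]a - e / 2, a[ &
    f a - f (a - e / 2) = df x * (a - (a - e / 2)).
  apply: MVT => //; last exact: continuous_subspaceT.
  by move=> x /[!in_itv]/= /andP[? xe]; apply: (H _ _ _).1 => //; exact: lt_trans ee _.
exists (a - e / 2); rewrite -subr_gt0 D; move: xI; rewrite in_itv/= => /andP[? xe].
by rewrite pmulr_rgt0 ?subr_gt0//; apply: (H _ _ _).2 => //; exact: lt_trans ee _.
Qed.

Lemma is_derive1_ge0_le f df a : continuous f ->
  (forall x, a < x -> is_derive x (1 : R) f (df x) /\ 0 <= df x) ->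
  forall x, a <= x -> f a <= f x.
Proof.
move=> cf H x; rewrite le_eqVlt => /predU1P[->//|ax].
have [z zI D] : exists2 z, z \in `]a, x[ & f x - f a = df z * (x - a).
  apply: MVT => //; last exact: continuous_subspaceT.
  by move=> z /[!in_itv]/= /andP[? _]; apply: (H _ _).1.
rewrite -subr_ge0 D mulr_ge0 ?subr_ge0 ?(ltW ax)//.
by move: zI; rewrite in_itv/= => /andP[? _]; apply: (H _ _).2.
Qed.

Lemma is_derive1_eq0_segment f a b : a <= b -> continuous f ->
  (forall x, a < x < b -> is_derive x (1 : R) f 0) ->
  forall x, a <= x <= b -> f x = f a.
Proof.
move=> ab cf H x /andP[]; rewrite le_eqVlt => /predU1P[->//|ax] xb.
have [z zI /eqP] : exists2 z, z \in `]a, x[ & f x - f a = cst 0 z * (x - a).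
  apply: MVT => //; last exact: continuous_subspaceT.
  move=> z /[!in_itv]/= /andP[az zx]; apply: H.
  by rewrite az (lt_le_trans zx).
by rewrite mul0r subr_eq0 => /eqP.
Qed.

(** The chord inequality with denominators cleared: z is the barycentre of x and
    y with weights y - z and z - x. *)
Lemma convex_chord c x y z : convex_function [set: R^o] c -> x < z < y ->
  (y - x) * c z <= (y - z) * c x + (z - x) * c y.
Proof.
move=> cvx /andP[xz zy].
have yx : 0 < y - x by rewrite subr_gt0 (lt_trans xz).
have t01 : 0 <= (y - z) / (y - x) <= 1.
  rewrite divr_ge0 ?(ltW yx) ?subr_ge0 ?(ltW zy)//=.
  by rewrite ler_pdivrMr// mul1r lerD2l lerN2 ltW.
have [t tE] : exists t : {i01 R}, t%:num = (y - z) / (y - x).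
  by exists (Itv01 (andP t01).1 (andP t01).2).
have yx0 : y - x != 0 by rewrite gt_eqF.
have := cvx t x y (mem_set I) (mem_set I).
rewrite !convRE [X in c X](_ : _ = z); last first.
  rewrite -[LHS]/(t%:num * x + unstable.onem t%:num * y) tE /unstable.onem.
  by field.
rewrite tE => H; rewrite -(ler_pM2l yx) in H; apply: le_trans H _.
by rewrite le_eqVlt; apply/orP; left; apply/eqP; rewrite /unstable.onem; field.
Qed.

(** Let x < y.  If the slope at x exceeded that of the chord from x to y, then c
    would lie strictly above the chord just to the right of x.  The case y < x is
    symmetric. *)
Lemma convex_tangent c x l : convex_function [set: R^o] c ->
  is_derive x (1 : R) c l -> forall y, c x + l * (y - x) <= c y.
Proof.
move=> cvx dc y.
have dg : is_derive x (1 : R) (fun z => c z - (c x + ((c y - c x) / (y - x)) * (z - x)))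
    (l - (c y - c x) / (y - x)).
  by apply: is_derive_eq; rewrite /GRing.scale/=; ring.
have [xy|yx|<-] := ltgtP x y; last by rewrite subrr mulr0 addr0.
- have yx0 : 0 < y - x by rewrite subr_gt0.
  have : l <= (c y - c x) / (y - x).
    rewrite leNgt -subr_gt0; apply/negP => l0.
    have [z [/= xz [/= zy]]] := filter_ex (filterI (nbhs_right_gt x)
      (filterI (nbhs_right_lt xy) (is_derive1_gt0_right dg l0))).
    rewrite subrr mulr0 addr0 subrr subr_gt0.
    have := @convex_chord c x y z cvx; rewrite xz zy => /(_ isT).
    move=> h1 h2.
    have : (y - x) * (c x + (c y - c x) / (y - x) * (z - x)) < (y - x) * c z.
      by rewrite ltr_pM2l.
    have -> : (y - x) * (c x + (c y - c x) / (y - x) * (z - x)) =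
       (y - z) * c x + (z - x) * c y by field; rewrite gt_eqF.
    by rewrite ltNge h1.
  by rewrite ler_pdivlMr// lerBrDl.
- have yx0 : 0 < x - y by rewrite subr_gt0.
  have : (c y - c x) / (y - x) <= l.
    rewrite leNgt -subr_lt0; apply/negP => l0.
    have dNg : is_derive x (1 : R)
        (\- (fun z => c z - (c x + ((c y - c x) / (y - x)) * (z - x))))
        (- (l - (c y - c x) / (y - x))) by exact: is_deriveN.
    rewrite -oppr_gt0 in l0.
    have [z [/= zx [/= yz]]] := filter_ex (filterI (nbhs_left_lt x)
      (filterI (nbhs_left_gt yx) (is_derive1_gt0_left dNg l0))).
    rewrite subrr mulr0 addr0 subrr ltrN2 subr_gt0.
    have := @convex_chord c y x z cvx; rewrite yz zx => /(_ isT).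
    move=> h1 h2.
    have : (x - y) * (c x + (c y - c x) / (y - x) * (z - x)) < (x - y) * c z.
      by rewrite ltr_pM2l.
    have -> : (x - y) * (c x + (c y - c x) / (y - x) * (z - x)) =
       (x - z) * c y + (z - y) * c x by field; rewrite lt_eqF// subr_lt0.
    by rewrite ltNge h1.
  by rewrite ler_ndivrMr ?subr_lt0// lerBrDl.
Qed.

(** Add the tangent inequalities at x and at y. *)
Lemma convex_derive_nondecreasing c dc : convex_function [set: R^o] c ->
  (forall x, is_derive x (1 : R) c (dc x)) -> {homo dc : x y / x <= y}.
Proof.
move=> cvx dcE x y; rewrite le_eqVlt => /predU1P[->//|xy].
have := convex_tangent cvx (dcE x) y; have := convex_tangent cvx (dcE y) x.
have yx : 0 < y - x by rewrite subr_gt0.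
move=> h1 h2; rewrite -(ler_pM2r yx); lra.
Qed.

Lemma nondecreasing_is_derive_ge0 f x l : {homo f : x y / x <= y} ->
  is_derive x (1 : R) f l -> 0 <= l.
Proof.
move=> ndf df; rewrite leNgt; apply/negP => l0.
have dNf : is_derive x (1 : R) (\- f) (- l) by exact: is_deriveN.
rewrite -oppr_gt0 in l0.
have [y [/= xy]] := filter_ex (filterI (nbhs_right_gt x) (is_derive1_gt0_right dNf l0)).
by rewrite ltrN2 ltNge ndf// ltW.
Qed.

(** A continuous function with compact support that is negative somewhere has a
    global minimum point, and the leftmost one is strictly below everything on
    its left.  Choosing the leftmost point is what later replaces the strict
    positivity of a zeroth order term in a maximum principle. *)
Lemma ge0_of_no_strict_left_min (h : R -> R) a b : continuous h ->
  (forall x, x <= a -> h x = 0) -> (forall x, b <= x -> h x = 0) ->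
  (forall x, a < x < b -> h x < 0 -> (forall y, h x <= h y) ->
     (forall y, y < x -> h x < h y) -> False) ->
  forall x, 0 <= h x.
Proof.
move=> ch ha hb absurd x; rewrite leNgt; apply/negP => hx.
have ab : a <= b.
  rewrite leNgt; apply/negP => ba.
  have [xa|/ltW ax] := leP x a; first by rewrite ha ?ltxx// in hx.
  by rewrite hb ?ltxx// in hx; apply: le_trans ax; exact: ltW.
have chs (A : set R) : {within A, continuous h} by exact: continuous_subspaceT.
have [m mab hm] := EVT_min ab (chs _).
have inab y : h y < 0 -> a < y < b.
  move=> hy; rewrite !ltNge; apply/andP; split; apply/negP => xa.
  - by rewrite ha ?ltxx// in hy.
  - by rewrite hb ?ltxx// in hy.
have hm0 : h m < 0.
  apply: (le_lt_trans _ hx); apply: hm.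
  by rewrite in_itv/=; have /andP[/ltW-> /ltW->] := inab _ hx.
have hmin y : h m <= h y.
  have [hy|hy] := leP 0 (h y); first by rewrite (le_trans (ltW hm0)).
  by apply: hm; rewrite in_itv/=; have /andP[/ltW-> /ltW->] := inab _ hy.
(* The minimum points form a compact set; p is its smallest element. *)
pose A := `[a, b]%classic `&` h @^-1` [set h m].
have cA : compact A.
  apply: (@subclosed_compact _ _ `[a, b]%classic).
  - apply: closedI; first exact: interval_closed.
    by apply: preimage_closed; [move=> ? _; exact: ch|exact: closed_eq].
  - exact: segment_compact.
  - by move=> ? [].
have [||p pA hp] := @compact_EVT_min R R idfun A _ cA.
- by exists m; split.
- by apply: continuous_subspaceT => ?.
move: pA; rewrite inE => -[_ /= pm].
apply: (absurd p); rewrite ?pm ?inab ?pm// => y yp.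
rewrite lt_neqAle hmin andbT; apply/eqP => hym.
have : h y < 0 by rewrite -hym.
move=> /inab/andP[/ltW ay /ltW yb].
have := hp y; rewrite inE => /(_ _)/=; rewrite leNgt yp => H.
suff : false by []. apply: H; split => //=; by rewrite in_itv/= ay yb.
Qed.

Lemma bounded_by_segment f a b : a <= b ->
  continuous f -> (forall x, x <= a -> f x = f a) ->
  (forall x, b <= x -> f x = f b) -> exists M, forall x, `|f x| <= M.
Proof.
move=> ab cf fa fb.
have cnf : {within `[a, b], continuous (fun x => `|f x|)}.
  apply: continuous_subspaceT => x.
  exact: (cvg_norm (cf x)).
have [m _ fm] := EVT_max ab cnf; exists `|f m| => x.
have [xa|/ltW ax] := leP x a; first by rewrite fa// fm// in_itv/= lexx ab.
have [xb|/ltW bx] := leP x b; last by rewrite fb// fm// in_itv/= lexx ab.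
by rewrite fm// in_itv/= ax xb.
Qed.

End calculus.

(** * The jump operator *)
Section law.
Context {R : realType}.

(** Every point outside the support lies in an open null interval with rational
    end points, and there are countably many of these. *)
Lemma negligible_msupportC (mu : {measure set R -> \bar R}) :
  mu.-negligible (~` msupport mu).
Proof.
pose J (p : rat * rat) : set R := `]ratr p.1, ratr p.2[%classic.
pose N (n : nat) : set R :=
  if unpickle n is Some p then (if mu (J p) == 0%E then J p else set0) else set0.
apply: (@negligibleS _ _ _ mu (\bigcup_n N n)).
  move=> x /= /existsNP[U] /not_implyP[oU] /not_implyP[Ux] /negP.
  rewrite -leNgt => muU.
  have /nbhs_ballP[e /= e0 eU] : nbhs x U by exact: open_nbhs_nbhs.
  have [p] : exists p : rat, ratr p \in `]x - e, x[ by apply: rat_in_itvoo; rewrite gtrBl.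
  have [q] : exists q : rat, ratr q \in `]x, x + e[ by apply: rat_in_itvoo; rewrite ltrDl.
  rewrite !in_itv/= => /andP[xq qe] /andP[pe px].
  have IU : J (p, q) `<=` U.
    move=> y; rewrite /J/= in_itv/= => /andP[py yq]; apply: eU.
    by rewrite /ball/= ltr_distlC; apply/andP; split;
      [exact: lt_trans py|exact: lt_trans qe].
  exists (pickle (p, q)); first exact: I.
  rewrite /N pickleK.
  have -> : mu (J (p, q)) == 0%E.
    rewrite eq_le measure_ge0 andbT (le_trans _ muU)// le_measure// inE.
      exact: measurable_itv.
    exact: measurable_realfun.open_measurable.
  by rewrite /J/= in_itv/= px.
apply: negligible_bigcup => n; rewrite /N.
case: unpickle => [p|]; last exact: negligible_set0.
case: ifPn => [/eqP|_]; last exact: negligible_set0.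
by move=> mup; exists (J p); split => //; exact: measurable_itv.
Qed.

(** Measurability is part of the definition, so that this is exactly what makes
    f (x + Y) integrable when Y is. *)
Definition linear_growth (f : R -> R) :=
  measurable_fun [set: R] f /\
  exists A B, forall x, `|f x| <= A + B * `|x|.

Lemma bounded_linear_growth (f : R -> R) M : continuous f ->
  (forall x, `|f x| <= M) -> linear_growth f.
Proof.
move=> cf fM; split; first exact: continuous_measurable_fun.
by exists M, 0 => x; rewrite mul0r addr0.
Qed.

Lemma is_derive1_linear_growth (f g : R -> R) M :
  (forall x, is_derive x (1 : R) f (g x)) -> (forall x, `|g x| <= M) ->
  linear_growth f.
Proof.
move=> fg gM.
have cf : continuous f by exact: is_derive1_continuous fg.
split; first exact: continuous_measurable_fun.
exists `|f 0|, M => x.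
have cW (A : set R) : {within A, continuous f} by exact: continuous_subspaceT.
have fgW (a b z : R) (_ : z \in `]a, b[) := fg z.
suff [z fx] : exists z, f x - f 0 = g z * x.
  rewrite -[f x](subrK (f 0)) addrC (le_trans (ler_normD _ _))// lerD2l fx.
  by rewrite normrM ler_wpM2r.
have [x0|x0] := leP 0 x.
  by have [z _] := MVT_segment x0 (fgW _ _) (cW _); rewrite subr0; exists z.
have [z _ E] := MVT_segment (ltW x0) (fgW _ _) (cW _).
by exists z; rewrite -opprB E sub0r mulrN opprK.
Qed.

Lemma mulr_linear_growth (k : R) : linear_growth (fun y : R => k * y).
Proof.
split; first exact: measurable_funM.
by exists 0, `|k| => x; rewrite add0r normrM.
Qed.

End law.

Section jumps.
Context d (T : measurableType d) (R : realType).
Variables (P : probability T R) (Y : {RV P >-> R}).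
Hypothesis Yint : P.-integrable [set: T] (EFin \o Y).
Local Notation mu := (distribution P Y).

Lemma integrable_law : mu.-integrable setT (EFin \o (id : R -> R)).
Proof.
apply: integrable_pushforward => //=; first exact: EFin_measurable.
Qed.

Lemma integral_law : \int[mu]_y y = fine 'E_P[Y]%E.
Proof.
rewrite /Rintegral unlock integral_distribution//=; exact: EFin_measurable.
Qed.

Lemma integrable_shift (f : R -> R) x : linear_growth f ->
  mu.-integrable setT (EFin \o (fun y => f (x + y))).
Proof.
move=> [mf [A [B fAB]]].
apply: (@le_integrable _ _ _ mu _ _ _
  (fun y => ((`|A| + `|B| * `|x|)%:E + (`|B|)%:E * `|y%:E|)%E)) => //.
- apply/measurable_EFinP; apply: (measurableT_comp mf).
  by apply: measurable_funD => //; exact: measurable_cst.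
- move=> y _ /=; rewrite lee_fin.
  rewrite (le_trans (fAB _))//.
  rewrite [leRHS]ger0_norm ?addr_ge0 ?mulr_ge0//.
  rewrite -addrA -mulrDr; apply: lerD; first exact: ler_norm.
  apply: (le_trans (ler_norm _)); rewrite normrM normr_id.
  by rewrite ler_wpM2l// ler_normD.
- apply: integrableD => //.
    exact: finite_measure_integrable_cst.
  by apply: integrableZl => //; apply: integrable_abse; exact: integrable_law.
Qed.

Lemma integrable_shiftB (f : R -> R) x : linear_growth f ->
  mu.-integrable setT (EFin \o (fun y => f (x + y) - f x)).
Proof.
move=> fl; have icst := finite_measure_integrable_cst mu (f x) measurableT.
exact: (integrableB measurableT (integrable_shift x fl) icst).
Qed.

Lemma PsiE (f : R -> R) x : linear_growth f ->
  Psi Y f x = \int[mu]_y (f (x + y) - f x).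
Proof.
move=> fl; rewrite RintegralB//; last 2 first.
- exact: integrable_shift.
- exact: finite_measure_integrable_cst.
by rewrite Rintegral_cst// [X in fine X](@probability_setT _ _ _ mu) mulr1.
Qed.

Lemma Psi_linear (k : R) : Psi Y (fun y => k * y) 0 = k * fine 'E_P[Y]%E.
Proof.
rewrite PsiE//; last exact: mulr_linear_growth.
rewrite -integral_law -RintegralZl//; last exact: integrable_law.
by apply: eq_Rintegral => y _; rewrite add0r mulr0 subr0.
Qed.

(** Differentiation under the integral, dominated by the constant M, on the
    neighbourhood (x - 1, x + 1) of x. *)
Lemma is_derive_Psi (f g : R -> R) (M : R) :
  linear_growth f -> (forall x, is_derive x (1 : R) f (g x)) ->
  (forall x, `|g x| <= M) ->
  forall x, is_derive x (1 : R) (Psi Y f) (Psi Y g x).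
Proof.
move=> fl fg gM x.
have dfy y z : is_derive z (1 : R) (fun z => f (z + y)) (g (z + y)).
  have h : is_derive z (1 : R) (fun z => z + y) 1 by apply: is_derive_eq; rewrite addr0.
  have := @is_derive1_comp _ f (fun z => z + y) z _ _ (fg (z + y)) h.
  by rewrite mulr1.
have M0 : 0 <= M by exact: le_trans (gM 0).
have xI : `]x - 1, x + 1[%classic x by rewrite /= in_itv/= gtrBl ltrDl ltr01.
have D : forall x0 y, (`]x - 1, x + 1[%classic : set R) x0 -> [set: R] y ->
    derivable (fun z => f (z + y)) x0 1.
  by move=> z y _ _; have [] := dfy y z.
have pE z y : partial1of2 (fun x y => f (x + y)) z y = g (z + y).
  by rewrite partial1of2E; exact: derive_val.
have gub : forall x0 y, (`]x - 1, x + 1[%classic : set R) x0 -> [set: R] y ->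
   `|partial1of2 (fun x y => f (x + y)) x0 y| <= M.
  by move=> z y _ _; rewrite pE.
have I0 : forall z, (`]x - 1, x + 1[%classic : set R) z ->
    mu.-integrable setT (EFin \o (fun y => f (z + y))).
  by move=> z _; exact: integrable_shift.
have intM : mu.-integrable setT (EFin \o cst M) by exact: finite_measure_integrable_cst.
have := @derivable_under_integral R _ _ mu (fun x y => f (x + y)) setT measurableT
   x (x - 1) (x + 1) xI I0 D (cst M) (fun=> M0) intM gub.
have := @differentiation_under_integral R _ _ mu (fun x y => f (x + y)) setT measurableT
   x (x - 1) (x + 1) xI I0 D (cst M) (fun=> M0) intM gub.
move=> E dF.
have dF' : is_derive x (1 : R) (fun z => \int[mu]_y f (z + y)) (\int[mu]_y g (x + y)).
  apply: DeriveDef => //; rewrite -derive1E E.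
  by apply: eq_Rintegral => y _; exact: pE.
exact: is_deriveB.
Qed.

Hypothesis supp_le0 : msupport mu `<=` `]-oo, 0].

Lemma law_gt0 : mu `]0, +oo[ = 0%E.
Proof.
have [N [mN N0 suppN]] : mu.-negligible (~` msupport mu).
  exact: negligible_msupportC.
apply: (subset_measure0 _ mN _ N0); first exact: measurable_itv.
apply: subset_trans suppN => x /=; rewrite in_itv/= andbT => x0 /supp_le0/=.
by rewrite in_itv/= leNgt x0.
Qed.

(** As the law of Y does not charge (0, +oo), only the behaviour of f to the left
    of x matters. *)
Lemma PsiE_le0 (f : R -> R) x : linear_growth f ->
  Psi Y f x = \int[mu]_(y in `]-oo, 0]) (f (x + y) - f x).
Proof.
move=> fl; rewrite PsiE// /Rintegral (@negligible_integral _ _ _ mu setT `]0, +oo[)//.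
- by rewrite setTD setCitvr.
- exact: (integrable_shiftB x fl).
- exact: law_gt0.
Qed.

Lemma le_Psi (f g : R -> R) x z : linear_growth f -> linear_growth g ->
  (forall y, y <= 0 -> f (x + y) - f x <= g (z + y) - g z) ->
  Psi Y f x <= Psi Y g z.
Proof.
move=> fl gl fg; rewrite !PsiE_le0//; apply: le_Rintegral => //.
- by apply: (integrableS _ _ _ (integrable_shiftB x fl)).
- by apply: (integrableS _ _ _ (integrable_shiftB z gl)).
Qed.

Lemma Psi_left_linear (f : R -> R) x k : linear_growth f ->
  (forall y, y <= 0 -> f (x + y) - f x = k * y) ->
  Psi Y f x = k * fine 'E_P[Y]%E.
Proof.
move=> fl fE; rewrite -Psi_linear; apply/eqP; rewrite eq_le.
have kl := mulr_linear_growth k.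
by rewrite !le_Psi// => y y0; rewrite fE// add0r mulr0 subr0.
Qed.

Lemma Psi_nondecreasing_le0 (f : R -> R) x : linear_growth f ->
  {homo f : x y / x <= y} -> Psi Y f x <= 0.
Proof.
move=> fl ndf; rewrite -[leRHS](mul0r (fine 'E_P[Y]%E)) -Psi_linear.
apply: le_Psi => //; first exact: mulr_linear_growth.
by move=> y y0; rewrite !mul0r subrr subr_le0 ndf// gerDl.
Qed.

(** For y <= 0 the increment V x - V (x + y) is the integral of H (x + s) over
    s in [y, 0].  Integrating in y and exchanging the integrals gives the
    integral over s <= 0 of H (x + s) P(Y <= s), which is Jop H x.  The exchange
    is legitimate because H is bounded and Y integrable. *)
Lemma Psi_antiderivative (V H : R -> R) (M : R) x :
  (forall z, is_derive z (1 : R) V (H z)) -> continuous H ->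
  (forall z, `|H z| <= M) -> Psi Y V x = - Jop Y H x.
Proof.
move=> dV cH HM.
have Vl := is_derive1_linear_growth dV HM.
pose leb := @lebesgue_measure R.
(* Pairs (y, s): y a jump size, s a displacement between the jump and 0. *)
pose D : set (R * R) := [set q | q.1 <= q.2 <= 0].
pose E : R * R -> R := fun p => H (x + p.2) * \1_D p.
have EE y s : E (y, s) = if y <= s <= 0 then H (x + s) else 0.
  rewrite /E indicE /=; case: ifPn => ys.
    by rewrite mem_set ?mulr1.
  by rewrite memNset ?mulr0//=; apply/negP.
have mD : measurable D.
  have m1 : measurable_fun setT (fun q : R * R => q.1 <= q.2).
    exact: measurable_fun_ler.
  have m2 : measurable_fun setT (fun q : R * R => q.2 <= 0).
    exact: measurable_fun_ler.
  have -> : D = (fun q : R * R => q.1 <= q.2) @^-1` [set true] `&`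
                (fun q : R * R => q.2 <= 0) @^-1` [set true].
    apply/seteqP; split => q; first by move/andP.
    by move=> [/= h1 h2]; rewrite /D/= h1 h2.
  apply: measurableI.
  - by have := m1 measurableT [set true]; rewrite setTI; exact.
  - by have := m2 measurableT [set true]; rewrite setTI; exact.
have mE : measurable_fun setT (EFin \o E).
  apply/measurable_EFinP/measurable_funM; last exact: measurable_indic.
  apply: (measurableT_comp (continuous_measurable_fun cH)).
  exact: measurable_funD.
have section1 y : (\int[leb]_s (E (y, s))%:E =
    \int[leb]_(s in `[y, 0%R]) (H (x + s)%R)%:E)%E.
  rewrite [RHS]integral_mkcond; apply: eq_integral => s _.
  by rewrite patchE mem_setE in_itv/= EE; case: ifP.
have section1V y : y <= 0 ->
    (\int[leb]_s (E (y, s))%:E = (V x - V (x + y))%:E)%E.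
  have dVx s : is_derive s (1 : R) (fun s => V (x + s)) (H (x + s)).
    have h : is_derive s (1 : R) (fun z => x + z) 1.
      by apply: is_derive_eq; rewrite add0r mulr1.
    have := @is_derive1_comp _ V (fun z => x + z) s _ _ (dV (x + s)) h.
    by rewrite mulr1.
  have cVx : continuous (fun s => V (x + s)).
    exact: is_derive1_continuous dVx.
  have cHx : continuous (fun s => H (x + s)).
    move=> s; apply: (continuous_comp (f := fun s => x + s)); last exact: cH.
    by apply: continuousD => //; exact: cst_continuous.
  rewrite section1 le_eqVlt => /predU1P[->|y0].
    by rewrite set_itv1 integral_set1 addr0 subrr.
  rewrite (@continuous_FTC2 R (fun s => H (x + s)) (fun s => V (x + s)))//=.
  - by rewrite addr0.
  - exact: continuous_subspaceT.
  - split.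
    + by move=> s _; case: (dVx s).
    + exact/cvg_at_right_filter/cVx.
    + exact/cvg_at_left_filter/cVx.
  - by move=> s _; rewrite derive1E; exact: derive_val.
have section1M y : (\int[leb]_s `|(E (y, s))%:E| <= (M * `|y|)%:E)%E.
  have M0 : 0 <= M by exact: le_trans (HM 0).
  apply: (@le_trans _ _ (\int[leb]_(s in `[y, 0%R]) (cst M%:E s))%E).
    rewrite [leRHS]integral_mkcond; apply: ge0_le_integral => //.
    - apply: measurableT_comp => //; apply: measurableT_comp mE _.
      exact: measurable_pair1.
    - exact/(measurable_restrictT _ _).1/measurable_cst.
    - move=> s _; rewrite patchE mem_setE in_itv/= EE; case: ifP => _.
        by rewrite lee_fin.
      by rewrite normr0.
  rewrite integral_cst//= lebesgue_measure_itv/=.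
  case: ifPn; rewrite lte_fin => y0; last by rewrite mule0 lee_fin mulr_ge0.
  by rewrite -EFinD -EFinM lee_fin sub0r ltr0_norm.
have section2 s : (\int[mu]_y (E (y, s))%:E =
   if (s <= 0)%R then (H (x + s) * fine (cdf Y s))%:E else 0)%E.
  case: ifPn => s0; last first.
    by apply: integral0_eq => y _; rewrite EE (negbTE s0) andbF.
  rewrite EFinM fineK ?fin_num_measure//.
  transitivity (\int[mu]_y ((H (x + s))%:E * (\1_`]-oo, s] y)%:E))%E.
    apply: eq_integral => y _; rewrite -EFinM EE s0 andbT indicE mem_setE.
    by rewrite in_itv/=; case: ifP; rewrite ?mulr1 ?mulr0.
  rewrite integralZl//; last exact: integrable_indic.
  by rewrite integral_indic// setIT.
have iE : (mu \x leb)%E.-integrable setT (EFin \o E).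
  apply/(@integrable12ltyP _ _ _ _ _ mu leb _ mE).
  apply: (@le_lt_trans _ _ (\int[mu]_y ((M%:E * `|y%:E|)))%E).
    apply: ge0_le_integral => //.
    - by move=> y _; exact: integral_ge0.
    - have mabsE : measurable_fun setT (fun p => `|(E p)%:E|%E).
        exact: measurableT_comp mE.
      exact: (@measurable_fun_fubini_tonelli_F _ _ _ _ R leb _ mabsE).
    - by apply: emeasurable_funM => //; apply: measurableT_comp.
    - by move=> y _; exact: section1M.
  have iM := integrableZl measurableT M (integrable_abse integrable_law).
  by have := integrable_lty measurableT iM.
have LE : (\int[mu]_y \int[leb]_s (EFin \o E) (y, s) =
    \int[mu]_(y in `]-oo, 0%R]) (V x - V (x + y))%:E)%E.
  rewrite [RHS]integral_mkcond; apply: eq_integral => y _.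
  rewrite patchE mem_setE in_itv/=; case: ifPn => y0; first exact: section1V.
  by rewrite /= section1 set_itv_ge ?integral_set0// bnd_simp.
have RE : (\int[leb]_s \int[mu]_y (EFin \o E) (y, s) =
    \int[leb]_(s in `]-oo, 0%R]) (H (x + s) * fine (cdf Y s))%:E)%E.
  rewrite [RHS]integral_mkcond; apply: eq_integral => s _.
  by rewrite patchE mem_setE in_itv/= section2.
rewrite PsiE_le0// /Jop /Rintegral -RE -(Fubini iE) LE.
transitivity (\int[mu]_(y in `]-oo, 0]) (-1 * (V x - V (x + y)))).
  by apply: eq_Rintegral => y _; rewrite mulN1r opprB.
rewrite RintegralZl//; first by rewrite mulN1r.
apply: (integrableS measurableT) => //.
have := integrableN (integrable_shiftB x Vl); apply: eq_integrable => // y _ /=.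
by rewrite opprB.
Qed.

Hypothesis Y_neg : (0 < P [set w | (Y w < 0)%R])%E.

(** The integrand f (x + y) - f x is nonnegative everywhere and positive for
    y < 0, a set of positive probability. *)
Lemma Psi_gt0 (f : R -> R) x : linear_growth f ->
  (forall y, f x <= f y) -> (forall y, y < x -> f x < f y) -> 0 < Psi Y f x.
Proof.
move=> fl fmin fleft.
pose g y := f (x + y) - f x.
have g0 y : 0 <= g y by rewrite /g subr_ge0.
have ig : mu.-integrable setT (EFin \o g) by exact: (integrable_shiftB x fl).
have mg : measurable_fun setT (EFin \o g) by exact: measurable_int ig.
rewrite PsiE// lt_neqAle; apply/andP; split; last first.
  by apply: Rintegral_ge0 => y _; exact: g0.
apply/negP => /eqP/esym int0.
have : (\int[mu]_y (EFin \o g) y = 0)%E.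
  by rewrite -[LHS]fineK ?integrable_fin_num//; congr EFin.
rewrite (eq_integral (fun y => `|(EFin \o g) y|)%E); last first.
  by move=> y _; rewrite /= ger0_norm.
move=> /(ae_eq_integral_abs mu measurableT mg)[N [mN N0 gN]].
have : mu `]-oo, 0%R[ = 0%E.
  apply: (subset_measure0 _ mN _ N0); first exact: measurable_itv.
  apply: subset_trans gN => y /=; rewrite in_itv/= => y0 /(_ I) [].
  by apply/eqP; rewrite gt_eqF// subr_gt0 fleft// gtrDl.
rewrite (_ : mu _ = P [set w | (Y w < 0)%R]); last first.
  by congr (P _); apply/seteqP; split => w /=; rewrite in_itv.
by move=> P0; have := Y_neg; rewrite P0 ltxx.
Qed.

End jumps.

(** * The free-boundary problem *)
Section free_boundary.
Context d (T : measurableType d) (R : realType).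
Variables (P : probability T R) (Y : {RV P >-> R}).
Hypothesis Yint : P.-integrable [set: T] (EFin \o Y).
Hypothesis supp_le0 : msupport (distribution P Y) `<=` `]-oo, 0].
Hypothesis Y_neg : (0 < P [set w | (Y w < 0)%R])%E.
Variables (sigma r delta eps cU cD b0 : R) (c : R -> R).
Variables (xlo xkappa xlambda xhi : R) (H : R -> R).
Hypotheses (sigma_gt0 : 0 < sigma) (r_gt0 : 0 < r) (eps_ge0 : 0 <= eps).
Hypotheses (eps_lt1 : eps < 1).
Hypotheses (xlo_lt_xkappa : xlo < xkappa) (xkappa_lt_xlambda : xkappa < xlambda).
Hypotheses (xlambda_lt_xhi : xlambda < xhi).
Hypothesis HP : solves_H_problem Y sigma r (fun=> b0) delta eps cU cD c
          xlo xkappa xlambda xhi H.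
Hypotheses (c_C2 : Ck_on 2 [set: R] c) (c_convex : convex_function [set: R^o] c).
Hypothesis dH_xkappa : 0 < (H^`())%classic xkappa.
Hypothesis dH_xlambda : 0 < (H^`())%classic xlambda.

Local Notation h := (H^`())%classic.
Local Notation dc := (c^`())%classic.
Local Notation rp := (r * (1 + eps)).
Local Notation rm := (r * (1 - eps)).

Definition drift kappa := b0 + sigma * kappa - r * fine 'E_P[Y]%E.

(** The value of h' obtained by solving L H + c' = 0 for the second derivative of
    H, with constant distortions kappa and lambda.  Unlike H'' itself it is
    defined and continuous on the whole line, which gives access to one-sided
    limits at the ends of the intervals where the equation holds. *)
Definition slope_rate kappa lambda x :=
  - (2 / sigma ^+ 2) * (drift kappa * h x + lambda * Psi Y H x + dc x).

Let sigma2_neq0 : sigma ^+ 2 != 0. Proof. by rewrite gt_eqF// exprn_gt0. Qed.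

Lemma is_derive_H x : is_derive x (1 : R) H (h x).
Proof.
case: HP => _ _ _ _ [[dH _] _]; rewrite derive1E; apply/derivableP.
exact: (dH 0%N x).
Qed.

Lemma continuous_h : continuous h.
Proof. by case: HP => _ _ _ _ [[_ cH] _] x; exact: cH. Qed.

Let H_lo x : x <= xlo -> H x = - cU.
Proof. by case: HP => _ [HE _] _ _ _; exact: HE. Qed.

Let H_hi x : xhi <= x -> H x = cD.
Proof. by case: HP => _ [_ HE] _ _ _; exact: HE. Qed.

Lemma h_lo x : x <= xlo -> h x = 0.
Proof.
move=> xl; apply: (is_derive1_eq0_left (is_derive_H x)) => y yx.
by rewrite (H_lo xl) (H_lo (le_trans yx xl)).
Qed.

Lemma h_hi x : xhi <= x -> h x = 0.
Proof.
move=> xl; apply: (is_derive1_eq0_right (is_derive_H x)) => y yx.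
by rewrite (H_hi xl) (H_hi (le_trans xl yx)).
Qed.

Let xlo_lt_xhi : xlo < xhi.
Proof. exact: lt_trans xlo_lt_xkappa (lt_trans xkappa_lt_xlambda xlambda_lt_xhi). Qed.

Lemma bounded_H : exists M, forall x, `|H x| <= M.
Proof.
apply: (bounded_by_segment (ltW xlo_lt_xhi)).
- exact: is_derive1_continuous is_derive_H.
- by move=> x xl; rewrite !H_lo.
- by move=> x xh; rewrite !H_hi.
Qed.

Lemma bounded_h : exists M, forall x, `|h x| <= M.
Proof.
apply: (bounded_by_segment (ltW xlo_lt_xhi)).
- exact: continuous_h.
- by move=> x xl; rewrite !h_lo.
- by move=> x xh; rewrite !h_hi.
Qed.

Lemma linear_growth_H : linear_growth H.
Proof. by have [M] := bounded_h; apply: is_derive1_linear_growth is_derive_H. Qed.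

Lemma linear_growth_h : linear_growth h.
Proof. by have [M] := bounded_h; apply: bounded_linear_growth continuous_h. Qed.

Lemma is_derive_PsiH x : is_derive x (1 : R) (Psi Y H) (Psi Y h x).
Proof.
have [M hM] := bounded_h.
exact: (is_derive_Psi Yint linear_growth_H is_derive_H hM).
Qed.

Lemma is_derive_c x : is_derive x (1 : R) c (dc x).
Proof.
by case: c_C2 => dcE _; rewrite derive1E; apply/derivableP; exact: (dcE 0%N x).
Qed.

Lemma is_derive_dc x : is_derive x (1 : R) dc (dc^`()%classic x).
Proof.
by case: c_C2 => dcE _; rewrite [dc^`()%classic x]derive1E; apply/derivableP;
  exact: (dcE 1%N x).
Qed.

Lemma nondecreasing_dc : {homo dc : x y / x <= y}.
Proof. exact: (convex_derive_nondecreasing c_convex is_derive_c). Qed.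

Lemma ddc_ge0 x : 0 <= dc^`()%classic x.
Proof. exact: (nondecreasing_is_derive_ge0 nondecreasing_dc (is_derive_dc x)). Qed.

Lemma continuous_slope_rate kappa lambda : continuous (slope_rate kappa lambda).
Proof.
move=> x; apply: cvgM; first exact: cvg_cst.
apply: cvgD; last exact: (is_derive1_continuous is_derive_dc).
apply: cvgD; first by apply: cvgM; [exact: cvg_cst|exact: continuous_h].
by apply: cvgM; [exact: cvg_cst|exact: (is_derive1_continuous is_derive_PsiH)].
Qed.

Definition slope_ode_on (a b kappa lambda : R) := forall x : R, a < x < b ->
  is_derive x (1 : R) h (slope_rate kappa lambda x).

(** The equation for H, on an interval where the switches are constant. *)
Let slope_ode_star (a b kappa lambda : R) :
  (forall x : R, a < x < b -> [/\ (`]xlo, xkappa[ `|` `]xkappa, xlambda[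
      `|` `]xlambda, xhi[)%classic x, kappa_star delta xkappa x = kappa &
      lambda_star r eps xlambda x = lambda]) ->
  slope_ode_on a b kappa lambda.
Proof.
move=> star x /star[xI kE lE].
case: HP => eqH _ _ _ [_ [dH _]].
have := eqH _ xI; rewrite /Lop kE lE derive1nS derive1n1 => E.
have := dH 1%N x isT xI; rewrite derive1n1 => dh.
have dhx : is_derive x (1 : R) h (h^`()%classic x).
  by rewrite [h^`()%classic x]derive1E; exact/derivableP.
apply: is_derive_eq; apply: (mulfI (x := 2^-1 * sigma ^+ 2)).
  by rewrite mulf_neq0 ?sigma2_neq0.
rewrite /slope_rate /drift.
move: E; set m := fine _; set p := Psi _ _ _ => E.
transitivity (- ((b0 + sigma * kappa - r * m) * h x + lambda * p + dc x)).
  by apply/eqP; rewrite -addr_eq0 -[X in _ == X]E; apply/eqP; ring.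
by field; rewrite gt_eqF.
Qed.

Lemma slope_ode_low : slope_ode_on xlo xkappa (- delta) rp.
Proof.
apply: slope_ode_star => x /andP[ax xb].
rewrite /kappa_star /lambda_star leNgt xb (ltW (lt_trans xb _))//.
by split=> //; left; left; rewrite /= in_itv/= ax.
Qed.

Lemma slope_ode_mid : slope_ode_on xkappa xlambda delta rp.
Proof.
apply: slope_ode_star => x /andP[ax xb].
rewrite /kappa_star /lambda_star (ltW ax) (ltW xb).
by split=> //; left; right; rewrite /= in_itv/= ax.
Qed.

Lemma slope_ode_high : slope_ode_on xlambda xhi delta rm.
Proof.
apply: slope_ode_star => x /andP[ax xb].
rewrite /kappa_star /lambda_star (ltW (lt_trans _ ax))// leNgt ax.
by split=> //; right; rewrite /= in_itv/= ax.
Qed.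

(** The maximum principle: at such a point the rate h' vanishes and has derivative
    - (2 / sigma^2) (lambda Psi h x + c'' x) < 0, so h' < 0 just to the right. *)
Lemma slope_ode_no_strict_left_min a b kappa lambda x : slope_ode_on a b kappa lambda ->
  0 < lambda -> a < x < b -> (forall y, h x <= h y) ->
  (forall y, y < x -> h x < h y) -> False.
Proof.
move=> reg lam0 xab hmin hleft; have /andP[ax xb] := xab.
have dhx := reg _ xab.
have rate0 : slope_rate kappa lambda x = 0.
  have dh0 : is_derive x (1 : R) h 0.
    apply: (@derive1_at_min _ _ a b); rewrite ?(ltW (lt_trans ax xb))//.
    by move=> t; rewrite in_itv/= => /reg[].
  by rewrite -(@derive_val _ _ _ _ _ _ _ dhx) (@derive_val _ _ _ _ _ _ _ dh0).
have drate : is_derive x (1 : R) (\- slope_rate kappa lambda)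
    (2 / sigma ^+ 2 * (lambda * Psi Y h x + dc^`()%classic x)).
  have := is_derive_PsiH x; have := is_derive_dc x; move=> d1 d2.
  rewrite /slope_rate; apply: is_derive_eq.
  rewrite rate0 /GRing.scale/=; ring.
have rate_gt0 : 0 < 2 / sigma ^+ 2 * (lambda * Psi Y h x + dc^`()%classic x).
  rewrite mulr_gt0 ?divr_gt0 ?exprn_gt0// ltr_pwDl ?ddc_ge0//.
  by rewrite mulr_gt0// (Psi_gt0 Yint)//; exact: linear_growth_h.
have [y] : exists y, h y < h x.
  apply: (decreases_right (df := slope_rate kappa lambda)) continuous_h _.
  near=> y; split.
    apply: reg; apply/andP; split.
      by rewrite (lt_trans ax)//; near: y; exact: nbhs_right_gt.
    by near: y; exact: nbhs_right_lt.
  rewrite -oppr_gt0 -[ltLHS]oppr0 -rate0; near: y.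
  exact: is_derive1_gt0_right drate rate_gt0.
by rewrite ltNge hmin.
Unshelve. all: by end_near. Qed.

(** The switching points cannot be minimum points with a negative value, as h is
    positive there; every other point of (xlo, xhi) is interior to an interval
    where the equation holds. *)
Lemma h_ge0 x : 0 <= h x.
Proof.
apply: (ge0_of_no_strict_left_min continuous_h h_lo h_hi).
move=> {}x /andP[xl xh] hx hmin hleft.
have rp0 : 0 < rp by rewrite mulr_gt0// ltr_pwDl.
have rm0 : 0 < rm by rewrite mulr_gt0// subr_gt0.
have [xk|kx|xE] := ltgtP x xkappa; last by move: hx; rewrite xE ltNge ltW.
  by apply: (slope_ode_no_strict_left_min slope_ode_low rp0 _ hmin hleft); rewrite xl.
have [xlam|lamx|xE] := ltgtP x xlambda; last by move: hx; rewrite xE ltNge ltW.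
  by apply: (slope_ode_no_strict_left_min slope_ode_mid rp0 _ hmin hleft); rewrite kx.
by apply: (slope_ode_no_strict_left_min slope_ode_high rm0 _ hmin hleft); rewrite lamx.
Qed.

Lemma nondecreasing_H : {homo H : x y / x <= y}.
Proof.
move=> x y; apply: (is_derive1_ge0_le (df := h)).
  exact: is_derive1_continuous is_derive_H.
by move=> z _; split; [exact: is_derive_H|exact: h_ge0].
Qed.

Lemma PsiH_le0 x : Psi Y H x <= 0.
Proof.
exact: (Psi_nondecreasing_le0 Yint supp_le0 _ linear_growth_H nondecreasing_H).
Qed.

(** All jumps from x stay in the half-line where H is constant. *)
Lemma PsiH_lo x : x <= xlo -> Psi Y H x = 0.
Proof.
move=> xl; rewrite -[RHS](mul0r (fine 'E_P[Y]%E)).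
apply: (Psi_left_linear Yint supp_le0 linear_growth_H) => y y0.
by rewrite !H_lo ?subrr ?mul0r// (le_trans _ xl)// gerDl.
Qed.

(** At xlo the terms in h and Psi H vanish, so c' xlo > 0 would make h' negative,
    hence h negative, just to the right of xlo. *)
Lemma dc_xlo_le0 : dc xlo <= 0.
Proof.
rewrite leNgt; apply/negP => dc0.
have [y] : exists y, h y < h xlo.
  apply: (decreases_right (df := slope_rate (- delta) rp)) continuous_h _.
  have rate0 : slope_rate (- delta) rp xlo < 0.
    rewrite /slope_rate h_lo// PsiH_lo// !mulr0 !add0r mulNr oppr_lt0.
    by rewrite mulr_gt0// divr_gt0// exprn_gt0.
  near=> y; split.
    by apply: slope_ode_low; apply/andP; split; near: y;
      [exact: nbhs_right_gt|exact: nbhs_right_lt].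
  near: y; apply: cvgr_lt rate0.
  exact/cvg_at_right_filter/continuous_slope_rate.
by rewrite (h_lo (lexx _)) ltNge h_ge0.
Unshelve. all: by end_near. Qed.

(** Otherwise h' would be positive, hence h negative, just to the left of xhi. *)
Lemma marginal_cost_xhi_ge0 : 0 <= rm * Psi Y H xhi + dc xhi.
Proof.
rewrite leNgt; apply/negP => dc0.
have [y] : exists y, h y < h xhi.
  apply: (decreases_left (df := slope_rate delta rm)) continuous_h _.
  have rate0 : 0 < slope_rate delta rm xhi.
    rewrite /slope_rate h_hi// mulr0 add0r nmulr_rgt0// oppr_lt0.
    by rewrite divr_gt0// exprn_gt0.
  near=> y; split.
    by apply: slope_ode_high; apply/andP; split; near: y;
      [exact: nbhs_left_gt|exact: nbhs_left_lt].
  near: y; apply: cvgr_gt rate0.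
  exact/cvg_at_left_filter/continuous_slope_rate.
by rewrite (h_hi (lexx _)) ltNge h_ge0.
Unshelve. all: by end_near. Qed.

Variable V : R -> R.
Hypothesis dV : forall x, is_derive x (1 : R) V (H x).

Lemma linear_growth_V : linear_growth V.
Proof. by have [M] := bounded_H; exact: is_derive1_linear_growth. Qed.

Lemma is_derive_PsiV x : is_derive x (1 : R) (Psi Y V) (Psi Y H x).
Proof.
have [M HM] := bounded_H.
exact: (is_derive_Psi Yint linear_growth_V dV HM).
Qed.

Lemma nonincreasing_PsiV x y : x <= y -> Psi Y V y <= Psi Y V x.
Proof.
move=> xy; rewrite -lerN2; move: y xy.
apply: (is_derive1_ge0_le (f := \- Psi Y V) (df := \- Psi Y H)).
  by move=> z; apply: continuousN; exact: (is_derive1_continuous is_derive_PsiV).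
move=> z _; split; last by rewrite oppr_ge0 PsiH_le0.
by have := is_derive_PsiV z => ?; exact: is_deriveN.
Qed.

Lemma PsiV_xlambda : Psi Y V xlambda = 0.
Proof.
have [M HM] := bounded_H.
rewrite (Psi_antiderivative Yint supp_le0 _ dV (is_derive1_continuous is_derive_H) HM).
by case: HP => _ _ _ -> _; rewrite oppr0.
Qed.

Lemma PsiV_lo x : x <= xlo -> Psi Y V x = - cU * fine 'E_P[Y]%E.
Proof.
move=> xl; apply: (Psi_left_linear Yint supp_le0 linear_growth_V) => y y0.
have cV (A : set R) : {within A, continuous V}.
  exact: continuous_subspaceT (is_derive1_continuous dV).
have xy : x + y <= x by rewrite gerDl.
have dVW (z : R) (_ : z \in `]x + y, x[) := dV z.
have [z + E] := MVT_segment xy dVW (cV _).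
rewrite in_itv/= => /andP[_ zx].
by rewrite -opprB E H_lo ?(le_trans zx)//; ring.
Qed.

(** L V + c with constant distortions kappa and lambda, and V', V'' written as H
    and h. *)
Definition generator_cost kappa lambda x :=
  drift kappa * H x + 2^-1 * sigma ^+ 2 * h x + lambda * Psi Y V x + c x.

Lemma continuous_generator_cost kappa lambda : continuous (generator_cost kappa lambda).
Proof.
move=> x; apply: cvgD; last exact: (is_derive1_continuous is_derive_c).
apply: cvgD; last first.
  by apply: cvgM; [exact: cvg_cst|exact: (is_derive1_continuous is_derive_PsiV)].
apply: cvgD; last by apply: cvgM; [exact: cvg_cst|exact: continuous_h].
by apply: cvgM; [exact: cvg_cst|exact: (is_derive1_continuous is_derive_H)].
Qed.

(** Differentiating L V + c gives L H + c'. *)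
Lemma generator_cost_cst (a b kappa lambda x : R) :
  slope_ode_on a b kappa lambda -> a <= b -> a <= x <= b ->
  generator_cost kappa lambda x = generator_cost kappa lambda a.
Proof.
move=> reg ab; apply: is_derive1_eq0_segment ab _ _ x.
  exact: continuous_generator_cost.
move=> x /reg dh.
have := is_derive_H x; have := is_derive_PsiV x; have := is_derive_c x => ? ? ?.
apply: is_derive_eq; rewrite /GRing.scale/= /slope_rate.
by field; rewrite gt_eqF.
Qed.

Local Notation gamma :=
  (cU * (delta * sigma - b0 - eps * r * fine 'E_P[Y]%E) + c xlo).

Lemma generator_cost_lo x : x <= xlo ->
  generator_cost (- delta) rp x = gamma + (c x - c xlo).
Proof.
by move=> xl; rewrite /generator_cost H_lo// h_lo// PsiV_lo// /drift; ring.
Qed.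

Let H_xkappa : H xkappa = 0. Proof. by case: HP. Qed.

Lemma generator_cost_low x : xlo <= x <= xkappa ->
  generator_cost (- delta) rp x = gamma.
Proof.
move=> xI; rewrite (generator_cost_cst slope_ode_low _ xI) ?ltW//.
by rewrite generator_cost_lo// subrr addr0.
Qed.

(** Switching kappa at xkappa changes only a multiple of H xkappa = 0. *)
Lemma generator_cost_mid x : xkappa <= x <= xlambda ->
  generator_cost delta rp x = gamma.
Proof.
move=> xI; rewrite (generator_cost_cst slope_ode_mid _ xI) ?ltW//.
rewrite -(generator_cost_low (x := xkappa)) ?lexx ?ltW//.
by rewrite /generator_cost H_xkappa !mulr0.
Qed.

(** Switching lambda at xlambda changes only a multiple of Psi V xlambda = 0. *)
Lemma generator_cost_high x : xlambda <= x <= xhi ->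
  generator_cost delta rm x = gamma.
Proof.
move=> xI; rewrite (generator_cost_cst slope_ode_high _ xI) ?ltW//.
rewrite -(generator_cost_mid (x := xlambda)) ?lexx ?ltW//.
by rewrite /generator_cost PsiV_xlambda !mulr0.
Qed.

(** For x >= xhi the derivative is r (1 - eps) Psi H x + c' x.  It is
    nonnegative at xhi, and nondecreasing because H (x + y) increases with x
    while H x stays equal to cD. *)
Lemma generator_cost_above x : xhi <= x -> gamma <= generator_cost delta rm x.
Proof.
move=> xh; rewrite -(generator_cost_high (x := xhi)) ?lexx ?(ltW xlambda_lt_xhi)//.
rewrite /generator_cost !H_hi// !h_hi// -!addrA !lerD2l.
apply: (is_derive1_ge0_le (f := fun x => rm * Psi Y V x + c x)
  (df := fun x => rm * Psi Y H x + dc x)) => //.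
  move=> z; apply: cvgD; last exact: (is_derive1_continuous is_derive_c).
  by apply: cvgM; [exact: cvg_cst|exact: (is_derive1_continuous is_derive_PsiV)].
move=> z /ltW xz; split.
  have := is_derive_PsiV z; have := is_derive_c z => ? ?.
  by apply: is_derive_eq; rewrite /GRing.scale/=; ring.
apply: (le_trans marginal_cost_xhi_ge0); apply: lerD; last exact: nondecreasing_dc.
rewrite ler_wpM2l ?mulr_ge0 ?subr_ge0 ?(ltW r_gt0) ?(ltW eps_lt1)//.
apply: (le_Psi Yint supp_le0) linear_growth_H linear_growth_H _ => y y0.
by rewrite (H_hi (lexx _)) (H_hi xz) lerD2r nondecreasing_H// lerD2r.
Qed.

Lemma c_lo x : x <= xlo -> c xlo <= c x.
Proof.
move=> xl; apply: le_trans (convex_tangent c_convex (is_derive_c xlo) x).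
by rewrite lerDl mulr_le0 ?dc_xlo_le0// subr_le0.
Qed.

Let dVE : (V^`())%classic = H.
Proof. by apply/funext => x; rewrite derive1E; exact: derive_val. Qed.

(** With the bang-bang choices, kappa V' is delta |V'| and lambda Psi V is
    r (Psi V + eps |Psi V|).  Any kappa and lambda that give these products at x
    therefore give the same generator. *)
Lemma LV_generator_cost kappa lambda x :
  kappa * H x = delta * `|H x| ->
  lambda * Psi Y V x = r * (Psi Y V x + eps * `|Psi Y V x|) ->
  LV Y sigma r (fun=> b0) delta eps V x + c x = generator_cost kappa lambda x.
Proof.
move=> kE lE; rewrite /LV /Lop /generator_cost derive1nS derive1n1 dVE lE.
have -> : lambdaV Y r eps V x * Psi Y V x =
    r * (Psi Y V x + eps * `|Psi Y V x|).
  rewrite /lambdaV; case: ifPn => [/ger0_norm ->|]; first by ring.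
  by rewrite -ltNge => /ltr0_norm ->; ring.
have kVE : kappaV delta V x * H x = kappa * H x.
  rewrite kE /kappaV dVE; case: ifPn => [/ger0_norm ->//|].
  by rewrite -ltNge => /ltr0_norm ->; rewrite mulNr mulrN.
congr (_ + _ + _ + _); rewrite /drift !mulrBl !mulrDl -!mulrA.
by rewrite kVE.
Qed.

Lemma worst_kappa_left x : x <= xkappa -> - delta * H x = delta * `|H x|.
Proof.
by move=> xk; rewrite ler0_norm ?mulNr ?mulrN// -H_xkappa nondecreasing_H.
Qed.

Lemma worst_kappa_right x : xkappa <= x -> delta * H x = delta * `|H x|.
Proof. by move=> xk; rewrite ger0_norm// -H_xkappa nondecreasing_H. Qed.

Lemma worst_lambda_left x : x <= xlambda ->
  rp * Psi Y V x = r * (Psi Y V x + eps * `|Psi Y V x|).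
Proof.
move=> xl; rewrite ger0_norm; first by ring.
by rewrite -PsiV_xlambda nonincreasing_PsiV.
Qed.

Lemma worst_lambda_right x : xlambda <= x ->
  rm * Psi Y V x = r * (Psi Y V x + eps * `|Psi Y V x|).
Proof.
move=> xl; rewrite ler0_norm; first by ring.
by rewrite -PsiV_xlambda nonincreasing_PsiV.
Qed.

Lemma free_boundary_solved :
  solves_free_boundary_problem Y sigma r (fun=> b0) delta eps cU cD c
    xlo xhi V gamma.
Proof.
split.
- move=> x; rewrite in_itv/= => /andP[xl xh].
  have [xk|/ltW kx] := leP x xkappa.
    have xlam := le_trans xk (ltW xkappa_lt_xlambda).
    rewrite (LV_generator_cost (worst_kappa_left xk) (worst_lambda_left xlam)).
    by rewrite generator_cost_low// xl.
  have [xlam|/ltW lamx] := leP x xlambda.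
    rewrite (LV_generator_cost (worst_kappa_right kx) (worst_lambda_left xlam)).
    by rewrite generator_cost_mid// kx.
  rewrite (LV_generator_cost (worst_kappa_right kx) (worst_lambda_right lamx)).
  by rewrite generator_cost_high// lamx.
- move=> x; rewrite in_itv/= negb_and -!ltNge => /orP[/ltW xl|/ltW xh].
    have xk := le_trans xl (ltW xlo_lt_xkappa).
    have xlam := le_trans xk (ltW xkappa_lt_xlambda).
    rewrite (LV_generator_cost (worst_kappa_left xk) (worst_lambda_left xlam)).
    by rewrite generator_cost_lo// lerDl subr_ge0 c_lo.
  have lamx := le_trans (ltW xlambda_lt_xhi) xh.
  have kx := le_trans (ltW xkappa_lt_xlambda) lamx.
  rewrite (LV_generator_cost (worst_kappa_right kx) (worst_lambda_right lamx)).
  exact: generator_cost_above.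
- move=> x; rewrite !in_itv/= dVE => /andP[/ltW xl /ltW xh].
  by rewrite -(H_lo (lexx xlo)) -(H_hi (lexx xhi)) !nondecreasing_H.
- by rewrite dVE; split.
- split=> [[|[|//]] x _ _|x _].
  + by case: (dV x).
  + by rewrite derive1n1 dVE; case: (is_derive_H x).
  + by rewrite derive1nS derive1n1 dVE; exact: continuous_h.
Qed.

End free_boundary.

Theorem theorem2
  (d : measure_display) (T : measurableType d) (R : realType)
  (P : probability T R) (Y : {RV P >-> R})
  (Yint : P.-integrable [set: T] (EFin \o Y))
  (sigma r delta eps cU cD : R)
  (sigma_gt0 : 0 < sigma) (r_gt0 : 0 < r) (delta_ge0 : 0 <= delta)
  (eps_ge0 : 0 <= eps) (eps_lt1 : eps < 1) (cU_gt0 : 0 < cU) (cD_gt0 : 0 < cD)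
  (b c : R -> R)
  (xlo xkappa xlambda xhi : R)
  (xlo_lt_xkappa : xlo < xkappa) (xkappa_lt_xlambda : xkappa < xlambda)
  (xlambda_lt_xhi : xlambda < xhi)
  (H : R -> R)
  (HP : solves_H_problem Y sigma r b delta eps cU cD c
          xlo xkappa xlambda xhi H)
  (supp_F : msupport (distribution P Y) `<=` `]-oo, 0])
  (Y_neg : (0 < P [set w | (Y w < 0)%R])%E)
  (b0 : R) (b_const : forall x, b x = b0)
  (c_C2 : Ck_on 2 [set: R] c)
  (c_convex : convex_function [set: R^o] c)
  (c_strict : strictly_convex_on `[xlo, xhi] c)
  (c_min : forall x : R, x != 0 -> c 0 < c x)
  (dH_xkappa : 0 < (H^`())%classic xkappa)
  (dH_xlambda : 0 < (H^`())%classic xlambda)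
  (V : R -> R) (dV : forall x : R, is_derive x (1 : R) V (H x)) :
  solves_free_boundary_problem Y sigma r b delta eps cU cD c xlo xhi V
    (cU * (delta * sigma - b0 - eps * r * fine ('E_P[Y])%E) + c xlo).
Proof.
have bE : b = fun=> b0 by apply/funext.
rewrite bE in HP *.
exact: (free_boundary_solved Yint supp_F Y_neg sigma_gt0 r_gt0 eps_ge0 eps_lt1
  xlo_lt_xkappa xkappa_lt_xlambda xlambda_lt_xhi HP c_C2 c_convex
  dH_xkappa dH_xlambda dV).
Qed.
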